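(* Let $n\ge 1$ and $N\ge 1$ be integers, let $L>0$, and for each $i\in\{1,\dots,n\}$ let $R_i:\mathbb{R}^N\to\mathbb{R}^N$ be $\frac1L$-cocoercive. Let $X^\star=\{x\in\mathbb{R}^N : 0=\frac1n\sum_{i=1}^n R_i x\}$ and suppose $X^\star\neq\emptyset$. Let $(x^k)_{k\in\mathbb{N}}$ and $(y_i^k)_{k\in\mathbb{N}}$, $i\in\{1,\dots,n\}$, be the random sequences generated by the SVAG algorithm (defined in the context) with step-size $\lambda>0$, innovation weight $\theta\in\mathbb{R}$ and given initial points $x^0,y_1^0,\dots,y_n^0\in\mathbb{R}^N$. If $$\frac{1}{L(2+|n-\theta|)}>\lambda,$$ then there is a (random) solution $x^\star\in X^\star$ such that, almost surely, $x^k\to x^\star$ and $y_i^k\to R_i x^\star$ for all $i\in\{1,\dots,n\}$ as $k\to\infty$. Moreover, for all $i\in\{1,\dots,n\}$, all $t\in\mathbb{N}$ and any $x^\star\in X^\star$, $$\min_{k\in\{0,\dots,t\}}\mathbb{E}\big[\|R_i x^k-R_i x^\star\|^2\big]\le \frac{n}{\lambda(L^{-1}-\lambda c)}\,\frac{1}{t+1}\,C_R,$$ $$\min_{k\in\{0,\dots,t\}}\mathbb{E}\big[\|y_i^k-R_i x^\star\|^2\big]\le \frac{n}{\lambda(L^{-1}-\lambda c)}\,\frac{1}{t+1}\,C_R,$$ where $c=2+|n-\theta|$ and $$C_R=\min_{x\in X^\star}\Big\{\|x^0-x\|^2+\frac{\lambda}{L}\sum_{i=1}^n\|y_i^0-R_i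 x^\star\|^2+\lambda^2(n-\theta)^2\Big\|\frac1n\sum_{i=1}^n y_i^0\Big\|^2-2\lambda(n-\theta)\Big\langle x^0-x,\frac1n\sum_{i=1}^n y_i^0\Big\rangle\Big\}.$$
   Context: $\mathbb{N}=\{0,1,2,\dots\}$; $\langle\cdot,\cdot\rangle$ and $\|\cdot\|$ are the standard Euclidean inner product and norm. An operator $R:\mathbb{R}^N\to\mathbb{R}^N$ is $\frac1L$-cocoercive if $\langle Rx-Ry,x-y\rangle\ge\frac1L\|Rx-Ry\|^2$ for all $x,y\in\mathbb{R}^N$. Under the assumptions, $R_i x^\star$ takes the same value for every $x^\star\in X^\star$. SVAG algorithm: given $R_1,\dots,R_n$, deterministic initial points $x^0,y_1^0,\dots,y_n^0\in\mathbb{R}^N$, step-size $\lambda>0$ and innovation weight $\theta\in\mathbb{R}$, for $k=0,1,\dots$: sample $i^k$ uniformly from $\{1,\dots,n\}$, independently of the past (i.e. $i^k$ is independent of a $\sigma$-algebra $\mathcal{F}_k$, with $\mathcal{F}_0\subset\mathcal{F}_1\subset\cdots$, for which the iterates $x^k,y_1^k,\dots,y_n^k$ are measurable), and set $$x^{k+1}=x^k-\lambda\Big(\frac{\theta}{n}\big(R_{i^k}x^k-y_{i^k}^k\big)+\frac1n\sum_{j=1}^n y_j^k\Big),\qquad y_{i^k}^{k+1}=R_{i^k}x^k,\qquad y_j^{k+1}=y_j^k\ \text{ for all } j\ne i^k.$$ *)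

(* Defs.v *)
From HB Require Import structures.
From mathcomp Require Import all_boot all_order all_algebra.
From mathcomp Require Import all_classical all_reals all_analysis.

Set Implicit Arguments.
Unset Strict Implicit.
Unset Printing Implicit Defensive.

Import Order.TTheory GRing.Theory Num.Theory.
Import numFieldNormedType.Exports.

Local Open Scope classical_set_scope.
Local Open Scope ring_scope.

(* Points of R^N are row vectors 'rV[R]_N.  The library norm `|x| on matrices
   is the sup norm, so the Euclidean structure is introduced separately. *)
Definition dotp (R : realType) (N : nat) (u v : 'rV[R]_N) : R :=
  \sum_(j < N) u 0 j * v 0 j.

Definition enorm (R : realType) (N : nat) (u : 'rV[R]_N) : R :=
  Num.sqrt (dotp u u).

Definition cocoercive (R : realType) (N : nat) (beta : R)
    (A : 'rV[R]_N -> 'rV[R]_N) : Prop :=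
  forall x y, dotp (A x - A y) (x - y) >= beta * enorm (A x - A y) ^+ 2.

Definition mean (R : realType) (N n : nat) (v : 'I_n -> 'rV[R]_N) : 'rV[R]_N :=
  n%:R^-1 *: \sum_(i < n) v i.

Definition solutions (R : realType) (N n : nat)
    (A : 'I_n -> 'rV[R]_N -> 'rV[R]_N) : set 'rV[R]_N :=
  [set x | 0 = mean (fun i => A i x)].

(* Measurability of an R^N-valued map with respect to a sigma-algebra G on T;
   R^N carries the product of the Borel sigma-algebras of its coordinates,
   which is its Borel sigma-algebra. *)
Definition vec_measurable (R : realType) (N : nat) (T : Type)
    (G : set (set T)) (X : T -> 'rV[R]_N) : Prop :=
  forall (j : 'I_N) (B : set R), measurable B -> G ((fun w => X w 0 j) @^-1` B).

(* x, y and I are the random sequences x^k, y_i^k and i^k, and F is the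
   filtration of past events.  'I_n carries the discrete sigma-algebra. *)
Record svag (R : realType) (N n : nat) (d : measure_display)
    (T : measurableType d) (P : probability T R)
    (A : 'I_n -> 'rV[R]_N -> 'rV[R]_N) (lambda theta : R)
    (x0 : 'rV[R]_N) (y0 : 'I_n -> 'rV[R]_N)
    (F : nat -> set (set T)) (I : nat -> T -> 'I_n)
    (x : nat -> T -> 'rV[R]_N) (y : nat -> 'I_n -> T -> 'rV[R]_N) : Prop := Svag {
  svag_filtration_sigma : forall k, sigma_algebra setT (F k);
  svag_filtration_sub : forall k, F k `<=` measurable;
  svag_filtration_incr : forall k, F k `<=` F k.+1;
  svag_x_adapted : forall k, vec_measurable (F k) (x k);
  svag_y_adapted : forall k i, vec_measurable (F k) (y k i);
  svag_I_measurable : forall k (S : set 'I_n), measurable (I k @^-1` S);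
  svag_I_uniform : forall k i, P (I k @^-1` [set i]) = (n%:R^-1)%:E;
  svag_I_indep : forall k (E : set T) (S : set 'I_n), F k E ->
    P (E `&` I k @^-1` S) = (P E * P (I k @^-1` S))%E;
  svag_x_init : forall w, x 0%N w = x0;
  svag_y_init : forall i w, y 0%N i w = y0 i;
  svag_x_step : forall k w,
    x k.+1 w = x k w - lambda *:
      ((theta / n%:R) *: (A (I k w) (x k w) - y k (I k w) w)
       + mean (fun j => y k j w));
  svag_y_step : forall k w i,
    y k.+1 i w = if i == I k w then A i (x k w) else y k i w
}.

(* The quantity minimized over x in C_R; xstar only enters through the values
   A i xstar. *)
Definition CR_objective (R : realType) (N n : nat)
    (A : 'I_n -> 'rV[R]_N -> 'rV[R]_N) (L lambda theta : R)
    (x0 : 'rV[R]_N) (y0 : 'I_n -> 'rV[R]_N) (xstar x : 'rV[R]_N) : R :=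
  enorm (x0 - x) ^+ 2
  + lambda / L * \sum_(i < n) enorm (y0 i - A i xstar) ^+ 2
  + lambda ^+ 2 * (n%:R - theta) ^+ 2 * enorm (mean y0) ^+ 2
  - 2 * lambda * (n%:R - theta) * dotp (x0 - x) (mean y0).

Definition is_minimum (R : realType) (E : set R) (m : R) : Prop :=
  E m /\ lbound E m.

(* Main.v *)
Require Import Defs.
From mathcomp Require Import all_boot all_order all_algebra.
From mathcomp Require Import all_classical all_reals all_analysis.
From mathcomp Require Import measurable_realfun ring lra.

Set Implicit Arguments.
Unset Strict Implicit.
Unset Printing Implicit Defensive.

Import Order.TTheory GRing.Theory Num.Theory.
Import numFieldNormedType.Exports.

Local Open Scope classical_set_scope.
Local Open Scope ring_scope.

(**
The key is the shifted iterate u = x - lambda (n - theta) ybar, where ybar is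
the mean of the stored values.  Because (theta + (n - theta)) / n = 1, one step
with sampled index i reads u+ = u - lambda (A_i x - y_i + ybar): whatever theta
is, the shifted iterate moves along the unbiased SAGA direction, evaluated at
the unshifted point x.  For a solution z put
  V_z = |u - z|^2 + (lambda / L) sum_i |y_i - A_i z|^2,
which expands at the initial state to the quantity minimized in C_R.  Averaging
V_z over i, cocoercivity together with Jensen's inequality applied to the means
of the vectors (A_i x - A_i z) + (y_i - A_i z) gives
  E_i V_z(next) <= V_z - (lambda / n) (1/L - lambda c) residual_z,
where residual_z = sum_i (|A_i x - A_i z|^2 + |y_i - A_i z|^2): this is
[lyapunov_descent], whose algebra is in [shifted_step_descent].  The step-size
condition says exactly that the factor of the residual is positive.

Rates.  Summing the inequality bounds the total expected residual by V_z at the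
initial state, so one of the first t + 1 expectations is at most their average
([min_expectation_le]).  Cocoercivity forces A_i z to be the same for all
solutions z, so z may be chosen to minimize V_z at the initial state; such a z
exists by [closest_solution], since only |u0 - z|^2 depends on z.

Almost sure convergence.  Summability makes the residual tend to 0 almost
surely, and V_z converges almost surely for each fixed solution z: this is the
convergence theorem for nonnegative supermartingales ([ae_cvg]), proved here
through a bound on upcrossings.  The state takes finitely many values at each
time, hence so does the history of states up to time k, and adaptedness together
with independence of the sampled index yields a one-step averaging formula for
arbitrary functions of the history ([avg_history_step]).  Both the summability and the upcrossing bounds are
instances of one monotonicity statement for functions of the history
([avg_potential_le]).

It remains to choose the exceptional null set independently of z.  Since
|u - z|^2 - |z|^2 is affine in z, it is enough to treat
finitely many solutions whose affine span contains all solutions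
([finite_affine_span]).  On the resulting event a cluster point p of u is a
solution because the residual vanishes in the limit, |u - p|^2 converges, and
its limit must be 0 ([opial_finite]).
*)

(** * Euclidean geometry and the one-step inequality *)

Section Euclidean.
Variables (R : realType) (N : nat).
Implicit Types u v w : 'rV[R]_N.

Lemma dotpC u v : dotp u v = dotp v u.
Proof. by apply: eq_bigr => j _; rewrite mulrC. Qed.

Lemma dotpDl u v w : dotp (u + v) w = dotp u w + dotp v w.
Proof. by rewrite /dotp -big_split /=; apply: eq_bigr => j _; rewrite mxE mulrDl. Qed.

Lemma dotpZl (k : R) u v : dotp (k *: u) v = k * dotp u v.
Proof. by rewrite /dotp mulr_sumr; apply: eq_bigr => j _; rewrite mxE mulrA. Qed.

Lemma dotpNl u v : dotp (- u) v = - dotp u v.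
Proof. by rewrite -scaleN1r dotpZl mulN1r. Qed.

Lemma dotpDr u v w : dotp w (u + v) = dotp w u + dotp w v.
Proof. by rewrite dotpC dotpDl !(dotpC w). Qed.

Lemma dotpZr (k : R) u v : dotp u (k *: v) = k * dotp u v.
Proof. by rewrite dotpC dotpZl (dotpC u). Qed.

Lemma dotpNr u v : dotp u (- v) = - dotp u v.
Proof. by rewrite dotpC dotpNl (dotpC u). Qed.

Definition dotpE := (dotpDl, dotpDr, dotpZl, dotpZr, dotpNl, dotpNr).

Lemma dotp0l v : dotp 0 v = 0.
Proof. by rewrite -(scale0r 0) dotpZl mul0r. Qed.

Lemma dotp_suml (J : Type) (r : seq J) (P : pred J) (f : J -> 'rV[R]_N) v :
  dotp (\sum_(i <- r | P i) f i) v = \sum_(i <- r | P i) dotp (f i) v.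
Proof.
by elim/big_rec2: _ => [|i y1 y2 _ <-]; rewrite ?dotp0l ?dotpDl.
Qed.

Lemma dotp_ge0 u : 0 <= dotp u u.
Proof. by apply: sumr_ge0 => j _; rewrite -expr2 sqr_ge0. Qed.

Lemma enorm_sqr u : enorm u ^+ 2 = dotp u u.
Proof. by rewrite sqr_sqrtr // dotp_ge0. Qed.

Lemma sqr_coord_le u j : u 0 j ^+ 2 <= dotp u u.
Proof.
rewrite /dotp (bigD1 j) //= expr2 lerDl.
by apply: sumr_ge0 => i _; rewrite -expr2 sqr_ge0.
Qed.

Lemma dotp_eq0 u : dotp u u <= 0 -> u = 0.
Proof.
move=> h; apply/rowP => j; rewrite mxE; apply/eqP; rewrite -sqrf_eq0 eq_le sqr_ge0 andbT.
exact: le_trans (sqr_coord_le u j) h.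
Qed.

Lemma dotp_add_le u v : dotp (u + v) (u + v) <= 2 * dotp u u + 2 * dotp v v.
Proof.
have := dotp_ge0 (u - v); rewrite !dotpE (dotpC v u); lra.
Qed.

Lemma norm_dotp_le u v : `|2 * dotp u v| <= dotp u u + dotp v v.
Proof.
have h1 := dotp_ge0 (u - v); have h2 := dotp_ge0 (u + v).
move: h1 h2; rewrite !dotpE (dotpC v u) => h1 h2.
by rewrite ler_norml; apply/andP; split; lra.
Qed.

End Euclidean.

Section Mean.
Variables (R : realType) (N n : nat) (hn : (0 < n)%N).
Implicit Types a b : 'I_n -> 'rV[R]_N.

Let n_neq0 : n%:R != 0 :> R. Proof. by rewrite pnatr_eq0 -lt0n. Qed.

Lemma sum_mean a : \sum_i a i = n%:R *: mean a.
Proof. by rewrite /mean scalerA divff // scale1r. Qed.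

(** The difference of the two sides is the sum of |a_i - mean a|^2. *)
Lemma mean_jensen a :
  n%:R * dotp (mean a) (mean a) <= \sum_i dotp (a i) (a i).
Proof.
have := sum_mean a; move: (mean a) => m sum_a.
have : 0 <= \sum_i dotp (a i - m) (a i - m).
  by apply: sumr_ge0 => i _; exact: dotp_ge0.
have -> : \sum_i dotp (a i - m) (a i - m)
    = \sum_i (dotp (a i) (a i) - 2 * dotp (a i) m + dotp m m).
  by apply: eq_bigr => i _; rewrite !dotpE (dotpC m (a i)); ring.
rewrite !big_split /= sumrN -mulr_sumr -dotp_suml sum_a sumr_const card_ord.
rewrite dotpZl -[_ *+ n]mulr_natl; lra.
Qed.

(** One step seen from a solution z, with a_i = A_i x - A_i z, b_i = y_i - A_i z,
    q = x - z and p = u - z; the conclusion is multiplied by n.  Expanding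
    the squares, cocoercivity pays for the cross term between q and the mean of
    the a_i, and three Jensen inequalities, for a, b and a + b, absorb the
    remaining products: the one for a + b compensates the bound
    |a - b|^2 <= 2 |a|^2 + 2 |b|^2 - |a + b|^2, and those for a and b control
    the product of the two means, which carries the factor delta. *)
Lemma shifted_step_descent (L lambda delta beta : R) a b (p q : 'rV[R]_N) :
  0 < L -> 0 < lambda ->
  p = q - (lambda * delta) *: mean b ->
  beta = \sum_i dotp (b i) (b i) ->
  L^-1 * \sum_i dotp (a i) (a i) <= \sum_i dotp (a i) q ->
  \sum_i (dotp (p - lambda *: (a i - b i + mean b))
               (p - lambda *: (a i - b i + mean b))
          + lambda / L * (beta + dotp (a i) (a i) - dotp (b i) (b i)))
  <= n%:R * (dotp p p + lambda / L * beta)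
     - lambda * (L^-1 - lambda * (2 + `|delta|))
       * \sum_i (dotp (a i) (a i) + dotp (b i) (b i)).
Proof.
move=> L0 l0 + beta_def coc.
have J1 := mean_jensen (fun i => a i + b i).
have mD : mean (fun i => a i + b i) = mean a + mean b.
  by rewrite /mean big_split /= scalerDr.
have := mean_jensen b; have := mean_jensen a.
have := sum_mean b; have := sum_mean a.
move: J1; rewrite mD; clear mD.
move: (mean a) (mean b) => am bm J1 sum_a sum_b J2 J3 p_def.
set alpha := \sum_i dotp (a i) (a i).
set gam := \sum_i dotp (a i) (b i).
have E1 : \sum_i dotp (p - lambda *: (a i - b i + bm)) (p - lambda *: (a i - b i + bm))
  = n%:R * dotp p p - 2 * lambda * (n%:R * dotp am p)
    + lambda ^+ 2 * (alpha + beta - 2 * gam + 2 * n%:R * dotp am bm - n%:R * dotp bm bm).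
  transitivity (\sum_i (dotp p p - 2 * lambda * (dotp (a i) p) + 2 * lambda * (dotp (b i) p)
     + lambda ^+ 2 * (dotp (a i) (a i)) + lambda ^+ 2 * (dotp (b i) (b i))
     - 2 * lambda ^+ 2 * (dotp (a i) (b i)) + 2 * lambda ^+ 2 * (dotp (a i) bm)
     - 2 * lambda ^+ 2 * (dotp (b i) bm)
     + (lambda ^+ 2 * (dotp bm bm) - 2 * lambda * dotp bm p))).
    apply: eq_bigr => i _; rewrite !dotpE.
    rewrite (dotpC p (a i)) (dotpC p (b i)) (dotpC p bm) (dotpC bm (a i)) (dotpC bm (b i))
       (dotpC (b i) (a i)); ring.
  rewrite !big_split /= !sumrN -!mulr_sumr -!dotp_suml sum_a sum_b !sumr_const !card_ord.
  rewrite -/alpha -beta_def -/gam -[p *+ n]scaler_nat -[bm *+ n]scaler_nat !dotpZl; ring.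
have E2 : \sum_i lambda / L * (beta + dotp (a i) (a i) - dotp (b i) (b i))
   = lambda / L * (n%:R * beta + alpha - beta).
  rewrite -mulr_sumr !big_split /= sumrN sumr_const card_ord -[beta *+ n]mulr_natl -beta_def.
  by [].
rewrite big_split /= E1 E2 big_split /= -/alpha -beta_def.
have sD : \sum_i dotp (a i + b i) (a i + b i) = alpha + beta + 2 * gam.
  transitivity (\sum_i (dotp (a i) (a i) + dotp (b i) (b i) + 2 * dotp (a i) (b i))).
    by apply: eq_bigr => i _; rewrite !dotpE (dotpC (b i) (a i)); ring.
  rewrite !big_split /= -mulr_sumr. by rewrite beta_def.
move: J1 J2 J3; rewrite sD -/alpha -beta_def => J1 J2 J3.
have J1' : n%:R * (dotp am am + 2 * dotp am bm + dotp bm bm) <= alpha + beta + 2 * gam.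
  by apply: le_trans J1; rewrite !dotpE (dotpC bm am) le_eqVlt; apply/orP; left; apply/eqP; ring.
have pE : n%:R * dotp am p = \sum_i dotp (a i) q - lambda * delta * (n%:R * dotp am bm).
  rewrite -dotp_suml sum_a p_def !dotpE; ring.
have n0 : 0 <= n%:R :> R by [].
have Xg : 0 <= n%:R * dotp am am by rewrite mulr_ge0 // dotp_ge0.
have Yg : 0 <= n%:R * dotp bm bm by rewrite mulr_ge0 // dotp_ge0.
have W : 2 * delta * (n%:R * dotp am bm) <= `|delta| * (alpha + beta).
  have h := norm_dotp_le am bm.
  apply: (@le_trans _ _ (`|delta| * (n%:R * (dotp am am + dotp bm bm)))).
    apply: le_trans (ler_norm _) _.
    have -> : 2 * delta * (n%:R * dotp am bm) = delta * (n%:R * (2 * dotp am bm)) by ring.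
    by rewrite normrM normrM (ger0_norm n0) ler_wpM2l // ler_wpM2l.
  by rewrite ler_wpM2l // mulrDr lerD.
rewrite pE.
have coc' : 2 * lambda * (L^-1 * alpha) <= 2 * lambda * (\sum_i dotp (a i) q).
  by rewrite ler_wpM2l // mulr_ge0 // ltW.
have K : alpha + beta - 2 * gam + 2 * n%:R * dotp am bm - n%:R * dotp bm bm
     + 2 * delta * (n%:R * dotp am bm) <= (2 + `|delta|) * (alpha + beta) by lra.
have K2 := ler_wpM2l (sqr_ge0 lambda) K.
move: coc' K2; set S := \sum_i dotp (a i) q; set W' := dotp am bm; set Y := dotp bm bm.
set l := L^-1 => c1 c2; rewrite -subr_ge0.
move: c1 c2; rewrite -[_ <= 2 * _ * S]subr_ge0 -[_ <= lambda ^+ 2 * ((2 + _) * _)]subr_ge0.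
move=> c1 c2; apply: le_trans (addr_ge0 c1 c2) _.
by rewrite le_eqVlt; apply/orP; left; apply/eqP; ring.
Qed.
End Mean.

(** * Upcrossings of a real sequence *)

(** Most recent value first, so that a recursion on the list follows time. *)
Fixpoint past (X : Type) (s : nat -> X) (k : nat) : seq X :=
  if k is k'.+1 then s k :: past s k' else [:: s 0%N].

Lemma map_past (X Y : Type) (f : X -> Y) (s : nat -> X) k :
  map f (past s k) = past (f \o s) k.
Proof. by elim: k => //= k ->. Qed.

Section Upcrossings.
Variable R : realType.
Implicit Types (a b : R) (v : nat -> R).

(** The flag tells that a value at most a was met and no value at least b since;
    the number counts the completed passages from below a to above b. *)
Definition upcross_step a b (u : R) (st : bool * nat) : bool * nat :=
  if st.1 then (if b <= u then (false, st.2.+1) else st) else (u <= a, st.2).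

Definition upcross a b (h : seq R) : bool * nat :=
  foldr (upcross_step a b) (false, 0%N) h.

Lemma upcross_pastS a b v k : upcross a b (past v k.+1) =
  upcross_step a b (v k.+1) (upcross a b (past v k)).
Proof. by []. Qed.

Lemma upcross_step_count a b u st : (st.2 <= (upcross_step a b u st).2)%N.
Proof. by rewrite /upcross_step; case: ifP => //; case: ifP. Qed.

Lemma upcross_count_mono a b v k j :
  ((upcross a b (past v k)).2 <= (upcross a b (past v (k + j))).2)%N.
Proof.
elim: j => [|j IH]; first by rewrite addn0.
by rewrite addnS upcross_pastS; apply: leq_trans IH (upcross_step_count _ _ _ _).
Qed.

Lemma upcross_past_last a b v k :
  exists st, upcross a b (past v k) = upcross_step a b (v k) st.
Proof. by case: k => [|k]; eexists. Qed.

Lemma upcross_hold a b v k : a < b -> v k <= a -> (upcross a b (past v k)).1.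
Proof.
move=> ab va; have [[[] c] ->] := upcross_past_last a b v k; rewrite /upcross_step /=.
  by rewrite leNgt (le_lt_trans va ab).
exact: va.
Qed.

(** Between the two times either the flag has stayed up, and then reaching b
    completes a passage, or a passage has been completed before. *)
Lemma upcross_release a b v k j :
  (upcross a b (past v k)).1 -> b <= v (k + j.+1)%N ->
  ((upcross a b (past v k)).2 < (upcross a b (past v (k + j.+1))).2)%N.
Proof.
move=> hold bv.
have keep i : (upcross a b (past v (k + i))).1 \/
    ((upcross a b (past v k)).2 < (upcross a b (past v (k + i))).2)%N.
  elim: i => [|i [IH|IH]]; first by left; rewrite addn0.
  - rewrite addnS upcross_pastS /upcross_step IH; case: ifP => _; last by left.
    by right; rewrite ltnS; exact: upcross_count_mono.
  - by right; rewrite addnS upcross_pastS; apply: leq_trans IH (upcross_step_count _ _ _ _).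
rewrite addnS upcross_pastS; have [h|h] := keep j.
  by rewrite /upcross_step h -addnS bv ltnS; exact: upcross_count_mono.
exact: leq_trans h (upcross_step_count _ _ _ _).
Qed.

Lemma upcross_unbounded a b v : a < b ->
  (forall K, exists2 k, (K <= k)%N & v k <= a) ->
  (forall K, exists2 k, (K <= k)%N & b <= v k) ->
  forall m, exists k, (m <= (upcross a b (past v k)).2)%N.
Proof.
move=> ab low high; elim=> [|m [k IH]]; first by exists 0%N.
have [k1 kk1 vk1] := low k; have [k2 kk2 vk2] := high k1.+1.
exists k2; apply: leq_ltn_trans IH _.
apply: leq_ltn_trans (upcross_count_mono a b v k (k1 - k)) _; rewrite subnKC //.
have e : k2 = (k1 + (k2 - k1.+1).+1)%N by rewrite addnS -addSn subnKC.
by rewrite e; apply: upcross_release; rewrite -?e //; exact: upcross_hold.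
Qed.

(** The limit is the lower limit of v, obtained as the supremum of the eventual
    lower bounds.  Were v not eventually below that supremum plus e, it would
    cross some rational interval infinitely often.  The bound M, required only
    infinitely often, excludes divergence to infinity. *)
Lemma cvg_of_upcross_bounded v :
  (forall k, 0 <= v k) ->
  (exists M, forall K, exists2 k, (K <= k)%N & v k <= M) ->
  (forall p q : rat, (p < q)%R ->
     exists m, forall k, ((upcross (ratr p) (ratr q) (past v k)).2 < m)%N) ->
  exists l : R, v k @[k --> \oo] --> l.
Proof.
move=> v0 [M vM] up.
pose E := [set c : R | exists K, forall k, (K <= k)%N -> c <= v k].
have supE : has_sup E.
  split; first by exists 0, 0%N => k _.
  exists M => c [K cK]; have [k Kk vk] := vM K.
  exact: le_trans (cK _ Kk) vk.
exists (sup E); apply/cvgrPdist_lt => e e0.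
have e4 : 0 < e / 4 by lra.
have [c [K cK] lc] := sup_adherent e0 supE.
have [p] := @rat_in_itvoo R (sup E) (sup E + e / 4) ltac:(lra).
rewrite in_itv /= => /andP[p1 p2].
have [q] := @rat_in_itvoo R (sup E + e / 4) (sup E + e / 2) ltac:(lra).
rewrite in_itv /= => /andP[q1 q2].
have pq : p < q by rewrite -(ltr_rat R) (lt_trans p2).
have [m um] := up _ _ pq.
have [K' hK'] : exists K', forall k, (K' <= k)%N -> v k < ratr q.
  apply: contrapT => nK.
  have high K' : exists2 k, (K' <= k)%N & ratr q <= v k.
    apply: contrapT => nk; apply: nK; exists K' => k kK; rewrite ltNge; apply/negP => qv.
    by apply: nk; exists k.
  have low K' : exists2 k, (K' <= k)%N & v k <= ratr p.
    apply: contrapT => nk.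
    suff /(ub_le_sup supE.2) : E (ratr p) by rewrite leNgt p1.
    exists K' => k kK; rewrite leNgt; apply/negP => /ltW pv.
    by apply: nk; exists k.
  have pqR : (ratr p : R) < ratr q by rewrite ltr_rat.
  have [k] := upcross_unbounded pqR low high m.
  by rewrite leqNgt um.
near=> k.
have h1 : c <= v k by apply: cK; near: k; exact: nbhs_infty_ge.
have h2 : v k < ratr q by apply: hK'; near: k; exact: nbhs_infty_ge.
rewrite ltr_norml; apply/andP; split; lra.
Unshelve. all: by end_near.
Qed.

End Upcrossings.

(** * Convergence and cluster points of row vectors *)

Section RowSequences.
Variables (R : realType) (N : nat).
Implicit Types (u : nat -> 'rV[R]_N) (p z : 'rV[R]_N).

Definition sqdist p z : R := dotp (p - z) (p - z).

Lemma sqdistC p z : sqdist p z = sqdist z p.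
Proof. by rewrite /sqdist -opprB dotpNl dotpNr opprK. Qed.

Lemma sqdist_ge0 p z : 0 <= sqdist p z.
Proof. exact: dotp_ge0. Qed.

Lemma sqdist_triangle p z w : sqdist p z <= 2 * sqdist p w + 2 * sqdist w z.
Proof.
by rewrite /sqdist -(subrKA w p (- z)); exact: dotp_add_le.
Qed.

(** Unlike the bound with constants 2 and 2, this one is sharp in the limit t -> 0
    and so can be used to pass to the limit in an optimal value. *)
Lemma sqdist_triangle_eps (t : R) p z w : 0 < t ->
  sqdist p z <= (1 + t) * sqdist p w + (1 + t^-1) * sqdist w z.
Proof.
move=> t0.
rewrite {1}/sqdist -(subrKA w p (- z)) /sqdist; move: (p - w) (w - z) => a b.
have h : 0 <= t^-1 * dotp (t *: a - b) (t *: a - b).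
  by rewrite mulr_ge0 ?dotp_ge0 // invr_ge0 ltW.
have e : t^-1 * dotp (t *: a - b) (t *: a - b)
    = t * dotp a a + t^-1 * dotp b b - 2 * dotp a b.
  by rewrite !dotpE (dotpC b a); field; rewrite gt_eqF.
move: h; rewrite e !dotpE (dotpC b a); lra.
Qed.

Lemma sqdist_eq p z : (forall e, 0 < e -> sqdist p z < e) -> p = z.
Proof.
move=> h; apply/eqP; rewrite -subr_eq0; apply/eqP/dotp_eq0.
by rewrite leNgt; apply/negP => /h; rewrite /sqdist ltxx.
Qed.

Lemma coord_cvg_of_sqdist u p j :
  sqdist (u k) p @[k --> \oo] --> (0 : R) -> u k 0 j @[k --> \oo] --> p 0 j.
Proof.
move=> /cvgrPdist_lt h; apply/cvgrPdist_lt => e e0.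
have := h (e ^+ 2) (exprn_gt0 2 e0); apply: filterS => k.
rewrite sub0r normrN ger0_norm ?sqdist_ge0 // => hk.
have := le_lt_trans (sqr_coord_le (u k - p) j) hk.
rewrite !mxE distrC -[X in X < _]real_normK ?num_real //.
by rewrite ltr_pXn2r ?nnegrE // ltW.
Qed.

(** The topology on row vectors is the one of the sup norm, for which
    convergence is coordinatewise. *)
Lemma cvg_of_sqdist u p :
  sqdist (u k) p @[k --> \oo] --> (0 : R) -> u k @[k --> \oo] --> p.
Proof.
move=> h; apply/cvg_ballP => e e0.
have H : \forall k \near \oo, forall j : 'I_N, ball (p 0 j) e (u k 0 j).
  apply: filter_forall => j.
  by move/cvg_ballP : (@coord_cvg_of_sqdist _ _ j h); exact.
by apply: filterS H => k Hk; split=> // i j; rewrite (ord1 i); exact: Hk.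
Qed.

Definition cluster_pt u p := 
  forall e K, 0 < e -> exists2 k, (K <= k)%N & sqdist (u k) p < e.

(** The sequence stays in a product of segments, which is compact. *)
Lemma bounded_cluster_pt u M :
  (forall k, dotp (u k) (u k) <= M) -> exists p, cluster_pt u p.
Proof.
move=> uM.
pose B := M + 1.
have M0 : 0 <= M := le_trans (dotp_ge0 _) (uM 0%N).
have hB k j : `[- B, B]%classic (u k 0 j).
  rewrite /= in_itv /= -ler_norml.
  have := le_trans (sqr_coord_le (u k) j) (uM k).
  rewrite -real_normK ?num_real // /B; move: `|u k 0 j| (normr_ge0 (u k 0 j)) => c c0 h; nra.
have := @rV_compact R N (fun=> `[- B, B]%classic) (fun=> @segment_compact R _ _).
have uB : (u @ \oo) [set v | forall j : 'I_N, `[- B, B]%classic (v ord0 j)].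
  by exists 0%N => // k _ j; exact: hB.
move=> /(_ (u @ \oo) _ uB) [p [_ clp]]; exists p => e K e0.
pose e' := Num.min 1 (e / (N%:R + 1)).
have N0 : 0 < N%:R + 1 :> R by rewrite ltr_wpDl.
have e'0 : 0 < e' by rewrite lt_min ltr01 divr_gt0.
have e'1 : e' <= 1 by rewrite ge_min lexx.
have e'2 : e' * (N%:R + 1) <= e by rewrite -ler_pdivlMr // ge_min lexx orbT.
have [q [[k Kk <-] Bq]] := clp [set u k | k in [set k | (K <= k)%N]] (ball p e')
   ltac:(by exists K => // k Kk; exists k) (nbhsx_ballx _ _ e'0).
exists k => //.
apply: (@le_lt_trans _ _ (N%:R * e' ^+ 2)).
  rewrite /sqdist /dotp mulr_natl -[X in e' ^+ 2 *+ X]card_ord -sumr_const.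
  apply: ler_sum => j _; rewrite !mxE -expr2 -real_normK ?num_real //.
  have /ltW := Bq.2 0 j; rewrite distrC => h.
  by rewrite ler_pXn2r ?nnegrE // ltW.
apply: lt_le_trans e'2.
have ee : e' * e' <= e' by rewrite ler_piMr // ltW.
have := ler_wpM2l (ler0n R N) ee; rewrite expr2; lra.
Qed.

(** Take points of S for which the differences with z0 span a subspace of largest
    dimension: adding a further point cannot enlarge it. *)
Lemma finite_affine_span (S : set 'rV[R]_N) z0 :
  exists2 s : seq 'rV[R]_N, (forall z, z \in s -> S z) &
    forall z, S z -> z - z0 \in <<[seq z' - z0 | z' <- s]>>%VS.
Proof.
pose Q m := `[< exists2 s : seq 'rV[R]_N, (forall z, z \in s -> S z)
   & \dim <<[seq z' - z0 | z' <- s]>> = m >].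
have exQ : exists m, Q m.
  by exists (\dim (<<[::]>> : {vspace 'rV[R]_N})); apply/asboolP; exists [::].
have ubQ m : Q m -> (m <= \dim {:'rV[R]_N})%N.
  by move=> /asboolP [s _ <-]; apply: dimvS; exact: subvf.
case: (ex_maxnP exQ ubQ) => m /asboolP[s sS sm] maxm; exists s => // z Sz.
apply: contrapT => /negP nz.
have : Q (\dim <<[seq z' - z0 | z' <- z :: s]>>).
  apply/asboolP; exists (z :: s) => // z'; rewrite inE => /orP[/eqP -> //|]; exact: sS.
move=> /maxm; apply/negP; rewrite -ltnNge -sm /= span_cons.
rewrite (ltn_leqif (dimv_leqif_sup (addvSr _ _))).
by apply: contra nz => /subvP; apply; exact: (subvP (addvSl _ _) _ (memv_line _)).
Qed.

Lemma cvg_dotp_span u (X : seq 'rV[R]_N) v :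
  (forall z, z \in X -> exists l : R, dotp (u k) z @[k --> \oo] --> l) ->
  v \in <<X>>%VS -> exists l : R, dotp (u k) v @[k --> \oo] --> l.
Proof.
move=> hX; rewrite -[X]/(tval (in_tuple X)) => /coord_span ->.
elim/big_ind : _.
- exists 0; under eq_fun do rewrite dotpC dotp0l; exact: cvg_cst.
- move=> a b [la ha] [lb hb]; exists (la + lb).
  by under eq_fun do rewrite dotpDr; exact: cvgD.
- move=> i _; have [l hl] := hX _ (mem_nth 0 (ltn_ord i)).
  exists (coord (in_tuple X) i v * l).
  by under eq_fun do rewrite dotpZr; exact: cvgMl_tmp.
Qed.

(** Finite form of Opial's argument.  The inner products of u - z0 with z - z0 are
    affine in squared distances, so they converge for z in s, hence for z in S
    by linearity.  Consequently |u - p|^2 converges for a cluster point p, and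
    the limit is 0 along the times at which u is close to p. *)
Lemma opial_finite (S : set 'rV[R]_N) u z0 (s : seq 'rV[R]_N) :
  (forall z, S z -> z - z0 \in <<[seq z' - z0 | z' <- s]>>%VS) ->
  (forall z, z \in z0 :: s -> exists l : R, sqdist (u k) z @[k --> \oo] --> l) ->
  (forall p, cluster_pt u p -> S p) ->
  exists2 p, S p & sqdist (u k) p @[k --> \oo] --> (0 : R).
Proof.
move=> span cvs clS.
have [l0 cv0] := cvs z0 (mem_head _ _).
have cvd v : v \in <<[seq z' - z0 | z' <- s]>>%VS ->
    exists l : R, dotp (u k - z0) v @[k --> \oo] --> l.
  apply: (@cvg_dotp_span (fun k => u k - z0)) => _ /mapP[z zs ->].
  have [l cv] : exists l : R, sqdist (u k) z @[k --> \oo] --> l.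
    by apply: cvs; rewrite inE zs orbT.
  exists ((l0 + sqdist z z0 - l) * 2^-1).
  have -> : (fun k => dotp (u k - z0) (z - z0)) =
      (fun k => (sqdist (u k) z0 + sqdist z z0 - sqdist (u k) z) * 2^-1).
    apply/funext => k; rewrite /sqdist.
    have -> : u k - z = (u k - z0) - (z - z0) by rewrite opprB addrA subrK.
    move: (u k - z0) (z - z0) => a b; rewrite !dotpE (dotpC b a); by field.
  by apply: cvgMr_tmp; apply: cvgB => //; apply: cvgD => //; exact: cvg_cst.
have [M uM] : exists M, forall k, dotp (u k) (u k) <= M.
  have /cvg_seq_bounded [M [_ hM]] : cvgn (fun k => sqdist (u k) z0).
    by apply/cvg_ex; exists l0.
  exists (2 * (M + 1) + 2 * dotp z0 z0) => k.
  have -> : u k = (u k - z0) + z0 by rewrite subrK.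
  apply: le_trans (dotp_add_le _ _) _; rewrite lerD2r ler_wpM2l //.
  by apply: le_trans (ler_norm _) _; apply: (hM (M + 1)) => //; rewrite ltrDl.
have [p clp] := bounded_cluster_pt uM.
exists p; first exact: clS.
have [l cvl] : exists l : R, sqdist (u k) p @[k --> \oo] --> l.
  have [l cv] := cvd _ (span _ (clS _ clp)).
  exists (l0 + sqdist p z0 - 2 * l).
  have -> : (fun k => sqdist (u k) p) =
      (fun k => sqdist (u k) z0 + sqdist p z0 - 2 * dotp (u k - z0) (p - z0)).
    apply/funext => k; rewrite /sqdist.
    have -> : u k - p = (u k - z0) - (p - z0) by rewrite opprB addrA subrK.
    move: (u k - z0) (p - z0) => a b; rewrite !dotpE (dotpC b a); ring.
  by apply: cvgB; [apply: cvgD => //; exact: cvg_cst | exact: cvgMl_tmp].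
suff l_eq0 : l = 0 by rewrite -l_eq0.
apply/eqP; rewrite -normr_le0 leNgt; apply/negP => l_gt0.
have l2 : 0 < `|l| / 2 by rewrite divr_gt0.
move/cvgrPdist_lt/(_ _ l2) : cvl => [K _ hK].
have [k Kk near_p] := clp _ K l2.
have := hK k Kk; rewrite ltr_distl => /andP[h1 h2].
have := ler_norm l; have := sqdist_ge0 (u k) p.
by case: (lerP 0 l) => hl; rewrite ?(ger0_norm hl) ?(ltr0_norm hl) in h1 h2 near_p *; lra.
Qed.

End RowSequences.

(** * Expectations of finitely valued random variables *)

Section BoundedInMean.
Context d (T : measurableType d) (R : realType) (P : probability T R).

Lemma integral_fin_ae (f : T -> \bar R) (C : R) :
  measurable_fun setT f -> (forall w, 0 <= f w)%E ->
  (\int[P]_w f w <= C%:E)%E -> {ae P, forall w, f w \is a fin_num}.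
Proof.
move=> mf f0 fC.
have intf : P.-integrable setT f.
  apply/integrableP; split => //.
  under eq_integral do rewrite gee0_abs //.
  exact: le_lt_trans fC (ltry _).
by apply: filterS (integrable_ae measurableT intf) => w; exact.
Qed.

(** The limit of g has a finite integral by monotone convergence. *)
Lemma ae_bounded_of_mean (g : nat -> T -> R) (C : R) :
  (forall k, measurable_fun setT (g k)) -> (forall k w, 0 <= g k w) ->
  (forall k w, g k w <= g k.+1 w) -> (forall k, 'E_P[g k] <= C%:E)%E ->
  {ae P, forall w, exists M, forall k, g k w <= M}.
Proof.
move=> mg g0 gS gC.
have gmono w : nondecreasing_seq (fun k => (g k w)%:E).
  by apply/nondecreasing_seqP => k; rewrite lee_fin.
have mgE k : measurable_fun setT (EFin \o g k) by exact/measurable_EFinP.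
have cvg_int := @cvg_monotone_convergence _ _ _ P setT measurableT
  (fun k w => (g k w)%:E) mgE (fun k w _ => g0 k w) (fun w _ => gmono w).
have cvw w := ereal_nondecreasing_is_cvgn (gmono w).
have : {ae P, forall w, limn (fun k => (g k w)%:E) \is a fin_num}.
  apply: (@integral_fin_ae _ C).
  - apply: (emeasurable_fun_cvg _ _ mgE) => w _; exact: cvw.
  - by move=> w; apply: lime_ge; [exact: cvw | apply: nearW => k; rewrite lee_fin].
  - rewrite -(cvg_lim _ cvg_int) //; apply: lime_le.
      by apply/cvg_ex; eexists; exact: cvg_int.
    by apply: nearW => k; have := gC k; rewrite unlock.
apply: filterS => w fin_lim; exists (fine (limn (fun k => (g k w)%:E))) => k.
rewrite -lee_fin fineK //.
rewrite (cvg_lim _ (ereal_nondecreasing_cvgn (gmono w))) //.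
by apply: ereal_sup_ubound; exists k.
Qed.

(** The lower limit of f has a finite integral by Fatou's lemma. *)
Lemma ae_liminf_bounded_of_mean (f : nat -> T -> R) (C : R) :
  (forall k, measurable_fun setT (f k)) -> (forall k w, 0 <= f k w) ->
  (forall k, 'E_P[f k] <= C%:E)%E ->
  {ae P, forall w, exists M, forall K, exists2 k, (K <= k)%N & f k w <= M}.
Proof.
move=> mf f0 fC.
have mfE k : measurable_fun setT (EFin \o f k) by exact/measurable_EFinP.
have fat := @fatou _ _ _ P setT measurableT (fun k w => (f k w)%:E) mfE (fun k w _ => f0 k w).
have leC : (limn_einf (fun k => \int[P]_w (f k w)%:E) <= C%:E)%E.
  rewrite limn_einf_lim; apply: lime_le; first exact: is_cvg_einfs.
  apply: nearW => k; apply: le_trans (fC k); rewrite unlock.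
  by apply: ereal_inf_lbound; exists k => /=.
have einfs_le w K : (einfs (fun k => (f k w)%:E) K <= limn_einf (fun k => (f k w)%:E))%E.
  rewrite limn_einf_lim (cvg_lim _ (ereal_nondecreasing_cvgn (nondecreasing_einfs _))) //.
  by apply: ereal_sup_ubound; exists K.
have : {ae P, forall w, limn_einf (fun k => (f k w)%:E) \is a fin_num}.
  apply: (@integral_fin_ae _ C).
  - apply: (emeasurable_fun_cvg _ _ (measurable_fun_einfs mfE)) => w _.
    rewrite limn_einf_lim; exact: is_cvg_einfs.
  - move=> w; apply: le_trans (einfs_le w 0%N).
    by apply: le_ereal_inf_tmp => _ [k _ <-]; rewrite lee_fin.
  - exact: le_trans fat leC.
apply: filterS => w fin_lim; exists (fine (limn_einf (fun k => (f k w)%:E)) + 1) => K.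
apply: contrapT => nK.
have : (limn_einf (fun k => (f k w)%:E) + 1 <= einfs (fun k => (f k w)%:E) K)%E.
  apply: le_ereal_inf_tmp => _ [k Kk <-].
  rewrite -(fineK fin_lim) -EFinD lee_fin leNgt; apply/negP => /ltW h; apply: nK; exists k => //.
move=> /le_trans /(_ (einfs_le w K)).
by rewrite -(fineK fin_lim) -EFinD lee_fin gerDl ler10.
Qed.

End BoundedInMean.

Section FinitelyValued.
Context d (T : measurableType d) (R : realType) (P : probability T R) (S : eqType).
Implicit Types (X : T -> S) (h g : S -> R) (r : seq S).

Definition finitely_valued X :=
  (exists r, forall w, X w \in r) /\ (forall v, measurable (X @^-1` [set v])).

(** Real-valued expectation, which loses nothing on finitely valued variables. *)
Definition avg X h : R := fine 'E_P[fun w => h (X w)].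

Lemma decompose_indic X h r w : uniq r -> X w \in r ->
  h (X w) = \sum_(v <- r) h v * \1_(X @^-1` [set v]) w.
Proof.
move=> ur Xr; rewrite (bigD1_seq (X w)) //= indicE mem_set // mulr1.
rewrite big1 ?addr0 // => v vX; rewrite indicE memNset ?mulr0 //= => e.
by rewrite e eqxx in vX.
Qed.

Lemma finitely_valued_measurable X h :
  finitely_valued X -> measurable_fun setT (h \o X).
Proof.
move=> [[r Xr] mX].
have -> : h \o X = fun w => \sum_(v <- undup r) h v * \1_(X @^-1` [set v]) w.
  by apply/funext => w; apply: decompose_indic; rewrite ?undup_uniq // mem_undup.
by apply: measurable_sum => v; apply: measurable_funM => //; exact: measurable_indic.
Qed.

Lemma expectation_finite_sum X h r : finitely_valued X -> uniq r ->
  (forall w, X w \in r) ->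
  ('E_P[fun w => h (X w)])%E = (\sum_(v <- r) h v * fine (P (X @^-1` [set v])))%:E.
Proof.
move=> [_ mX] ur Xr; rewrite unlock.
under eq_integral => w _ do rewrite (decompose_indic h ur (Xr w)) -sumEFin.
have int_indic v : P.-integrable setT (fun w => (\1_(X @^-1` [set v]) w)%:E : \bar R).
  exact: integrable_indic.
rewrite integral_sum //; last first.
  by move=> v; under eq_fun do rewrite EFinM; exact: integrableZl.
rewrite -sumEFin; apply: eq_bigr => v _.
under eq_integral do rewrite EFinM.
rewrite integralZl // integral_indic // setIT EFinM fineK //.
exact: fin_num_measure.
Qed.

Lemma finitely_valued_uniq X : finitely_valued X ->
  exists2 r, uniq r & forall w, X w \in r.
Proof. by move=> [[r Xr] _]; exists (undup r) => [|w]; rewrite ?undup_uniq ?mem_undup. Qed.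

Lemma avg_sum X h r : finitely_valued X -> uniq r -> (forall w, X w \in r) ->
  avg X h = \sum_(v <- r) h v * fine (P (X @^-1` [set v])).
Proof. by move=> fX ur Xr; rewrite /avg (expectation_finite_sum _ fX ur Xr). Qed.

Lemma expectation_avg X h : finitely_valued X ->
  ('E_P[fun w => h (X w)])%E = (avg X h)%:E.
Proof.
move=> fX; have [r ur Xr] := finitely_valued_uniq fX.
by rewrite (avg_sum _ fX ur Xr) (expectation_finite_sum _ fX ur Xr).
Qed.

Lemma avg_le X h g : finitely_valued X -> (forall w, h (X w) <= g (X w)) ->
  avg X h <= avg X g.
Proof.
move=> fX hg; have [r ur Xr] := finitely_valued_uniq fX.
rewrite !(avg_sum _ fX ur Xr); apply: ler_sum => v _.
have [->|/set0P [w <-]] := eqVneq (X @^-1` [set v]) set0.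
  by rewrite measure0 !mulr0.
by apply: ler_wpM2r => //; rewrite fine_ge0.
Qed.

Lemma avg_cst X c : finitely_valued X -> avg X (fun=> c) = c.
Proof. by move=> fX; rewrite /avg (expectation_cst P c). Qed.

Lemma avgD X h g : finitely_valued X -> avg X (fun v => h v + g v) = avg X h + avg X g.
Proof.
move=> fX; have [r ur Xr] := finitely_valued_uniq fX.
by rewrite !(avg_sum _ fX ur Xr) -big_split /=; apply: eq_bigr => v _; rewrite mulrDl.
Qed.

Lemma avgZ X c h : finitely_valued X -> avg X (fun v => c * h v) = c * avg X h.
Proof.
move=> fX; have [r ur Xr] := finitely_valued_uniq fX.
by rewrite !(avg_sum _ fX ur Xr) mulr_sumr; apply: eq_bigr => v _; rewrite mulrA.
Qed.

End FinitelyValued.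

(** * Chains driven by uniform innovations *)

Lemma sigma_algebra_setI (T : Type) (G : set (set T)) :
  sigma_algebra setT G -> setI_closed G.
Proof. by move=> /(sigma_algebraP (fun X _ => @subsetT _ X)) []. Qed.

Section UniformChain.
Context d (T : measurableType d) (R : realType) (P : probability T R).
Variables (n : nat) (S : eqType) (step : 'I_n -> S -> S) (s_init : S).
Variables (F : nat -> set (set T)) (I : nat -> T -> 'I_n) (s : nat -> T -> S).

(** The index I k is independent of F k, but it need not be measurable for F k.+1:
    only the states are adapted.  This is why the results below speak of the
    history of states and not of the sampled indices. *)
Record uniform_chain : Prop := UniformChain {
  chain_sigma : forall k, sigma_algebra setT (F k);
  chain_measurable : forall k, F k `<=` measurable;
  chain_incr : forall k, F k `<=` F k.+1;
  chain_adapted : forall k v, F k (s k @^-1` [set v]);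
  chain_I_measurable : forall k (E : set 'I_n), measurable (I k @^-1` E);
  chain_I_uniform : forall k i, P (I k @^-1` [set i]) = (n%:R^-1)%:E;
  chain_I_indep : forall k (E : set T) (D : set 'I_n), F k E ->
    P (E `&` I k @^-1` D) = (P E * P (I k @^-1` D))%E;
  chain_init : forall w, s 0%N w = s_init;
  chain_step : forall k w, s k.+1 w = step (I k w) (s k w)
}.

Hypothesis chain : uniform_chain.

Definition history k w : seq S := past (s^~ w) k.

Lemma head_history k w : head s_init (history k w) = s k w.
Proof. by rewrite /history; case: k. Qed.

Lemma historyS k w :
  history k.+1 w = step (I k w) (head s_init (history k w)) :: history k w.
Proof.
by rewrite head_history /history /= (chain_step chain).
Qed.

Lemma history_adapted k h : F k (history k @^-1` [set h]).
Proof.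
elim: k h => [|k IH] h.
  have [[v ->]|nh] := pselect (exists v, h = [:: v]).
    suff -> : history 0 @^-1` [set [:: v]] = s 0%N @^-1` [set v].
      exact: (chain_adapted chain).
    by apply/seteqP; split => w; rewrite /history /preimage /=; [case | move=> ->].
  suff -> : history 0 @^-1` [set h] = set0.
    by case: (chain_sigma chain 0).
  by rewrite -subset0 => w; rewrite /history /= => e; apply: nh; exists (s 0%N w).
case: h => [|v h].
  suff -> : history k.+1 @^-1` [set [::]] = set0.
    by case: (chain_sigma chain k.+1).
  by rewrite -subset0 => w.
suff -> : history k.+1 @^-1` [set v :: h]
    = s k.+1 @^-1` [set v] `&` history k @^-1` [set h].
  apply: (sigma_algebra_setI (chain_sigma chain k.+1)).
    exact: (chain_adapted chain).
  exact: (chain_incr chain).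
by apply/seteqP; split => w; rewrite /history /=; case=> -> ->.
Qed.

Lemma history_measurable k h : measurable (history k @^-1` [set h]).
Proof. exact: ((@chain_measurable chain k) _ (history_adapted k h)). Qed.

Lemma history_finitely_valued k : finitely_valued (history k).
Proof.
split; last exact: history_measurable.
elim: k => [|k [r Hr]].
  by exists [:: [:: s_init]] => w; rewrite /history /= (chain_init chain) mem_head.
exists [seq step i (head s_init h) :: h | h <- r, i <- enum 'I_n] => w.
rewrite historyS; apply/allpairsP; exists (history k w, I k w) => /=.
by rewrite Hr mem_enum.
Qed.

(** The pair formed by the history and the new index is finitely valued, and its
    law is a product since each event of the history belongs to F k. *)
Lemma avg_history_step k (Phi : seq S -> R) :
  avg P (history k.+1) Phi =
  avg P (history k)
    (fun h => n%:R^-1 * \sum_(i < n) Phi (step i (head s_init h) :: h)).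
Proof.
have fH := history_finitely_valued k.
have [r ur Hr] := finitely_valued_uniq fH.
pose X w := (history k w, I k w).
have XE h i : X @^-1` [set (h, i)] = history k @^-1` [set h] `&` I k @^-1` [set i].
  by apply/seteqP; split => w; rewrite /X /=; case=> -> ->.
have PX h i : fine (P (X @^-1` [set (h, i)])) =
    n%:R^-1 * fine (P (history k @^-1` [set h])).
  rewrite XE (chain_I_indep chain) ?(chain_I_uniform chain); last exact: history_adapted.
  rewrite fineM ?fin_num_measure //; first by rewrite mulrC.
  exact: history_measurable.
have fX : finitely_valued X.
  split.
    by exists [seq (h, i) | h <- r, i <- enum 'I_n] => w; apply/allpairsP;
       exists (X w); rewrite Hr mem_enum.
  move=> [h i]; rewrite XE; apply: measurableI.
    exact: history_measurable.
  exact: (chain_I_measurable chain).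
have -> : avg P (history k.+1) Phi =
    avg P X (fun p => Phi (step p.2 (head s_init p.1) :: p.1)).
  by rewrite /avg; under eq_fun do rewrite historyS.
rewrite (avg_sum _ _ fX (r := [seq (h, i) | h <- r, i <- enum 'I_n])); last 2 first.
- by apply: allpairs_uniq => //; [exact: enum_uniq | move=> [? ?] [? ?] _ _ /=].
- by move=> w; apply/allpairsP; exists (X w); rewrite Hr mem_enum.
rewrite big_allpairs (avg_sum _ _ fH ur Hr); apply: eq_bigr => h _ /=.
rewrite mulr_sumr mulr_suml big_enum /=; apply: eq_bigr => i _.
by rewrite PX mulrCA mulrA.
Qed.

(** The descent is required from every nonempty list of states, reachable or not,
    so that it can be checked without knowing the law of the chain. *)
Lemma avg_potential_le (Phi : seq S -> R) :
  (forall v h, n%:R^-1 * \sum_(i < n) Phi (step i v :: v :: h) <= Phi (v :: h)) ->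
  forall k, avg P (history k) Phi <= Phi [:: s_init].
Proof.
move=> desc; elim=> [|k IH].
  rewrite -(avg_cst P (Phi [:: s_init]) (history_finitely_valued 0)).
  apply: avg_le; first exact: history_finitely_valued.
  by move=> w; rewrite /history /= (chain_init chain).
rewrite avg_history_step; apply: le_trans IH.
apply: avg_le; first exact: history_finitely_valued.
by move=> w; rewrite /history; case: k => [|k]; exact: desc.
Qed.

Section Supermartingale.
Variables (V Q : S -> R).
Hypothesis n_gt0 : (0 < n)%N.
Hypothesis V_ge0 : forall v, 0 <= V v.
Hypothesis Q_ge0 : forall v, 0 <= Q v.
Hypothesis descent : forall v, n%:R^-1 * \sum_(i < n) V (step i v) <= V v - Q v.

Let average_cst (c : R) : n%:R^-1 * \sum_(i < n) c = c.
Proof.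
by rewrite sumr_const card_ord -[c *+ n]mulr_natl mulrA mulVf ?mul1r // pnatr_eq0 -lt0n.
Qed.

(** Total decrease already granted: the current state is left out because its
    decrease is only realized by the next step. *)
Definition paid (h : seq S) : R := \sum_(v <- behead h) Q v.

(** V at the current state plus the decrease granted so far is a potential. *)
Lemma avg_paid_le k :
  avg P (history k) (fun h => V (head s_init h) + paid h) <= V s_init.
Proof.
apply: le_trans (avg_potential_le _ k) _ => [v h|]; last by rewrite /paid /= big_nil addr0.
rewrite /paid /= big_split /= mulrDr big_cons average_cst.
by have := descent v; lra.
Qed.

Lemma finitely_valued_state k : finitely_valued (s k).
Proof.
split; last by move=> v; exact: ((@chain_measurable chain k) _ (chain_adapted chain k v)).
have [[r Hr] _] := history_finitely_valued k.
exists (map (head s_init) r) => w; rewrite -head_history; exact: map_f.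
Qed.

Lemma avg_state k (f : S -> R) :
  avg P (s k) f = avg P (history k) (fun h => f (head s_init h)).
Proof. by rewrite /avg; under [in RHS]eq_fun do rewrite head_history. Qed.

Lemma avg_state_le k : avg P (s k) V <= V s_init.
Proof.
rewrite avg_state; apply: le_trans (avg_paid_le k); apply: avg_le.
  exact: history_finitely_valued.
by move=> w; rewrite lerDl; apply: sumr_ge0.
Qed.

Lemma avg_paid k : avg P (history k) paid = \sum_(j < k) avg P (s j) Q.
Proof.
elim: k => [|k IH].
  rewrite big_ord0 -[RHS](avg_cst P 0 (history_finitely_valued 0)) /avg.
  by congr (fine _); congr ('E_P[_])%E; apply/funext => w; rewrite /paid /= big_nil.
rewrite big_ord_recr /= -IH avg_state -avgD; last exact: history_finitely_valued.
rewrite /avg; congr (fine _); congr ('E_P[_])%E; apply/funext => w.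
by rewrite /paid /history; case: k {IH} => [|k] /=; rewrite ?big_cons ?big_nil addrC.
Qed.

Lemma sum_avg_le k : \sum_(j < k) avg P (s j) Q <= V s_init.
Proof.
rewrite -avg_paid; apply: le_trans (avg_paid_le k); apply: avg_le.
  exact: history_finitely_valued.
by move=> w; rewrite lerDr.
Qed.

(** Otherwise the total of the t + 1 expected decreases would exceed V s_init. *)
Lemma min_expectation_le (kappa : R) (f : S -> R) t : 0 < kappa ->
  (forall v, kappa * f v <= Q v) ->
  (\big[Order.min/+oo]_(k < t.+1) 'E_P[fun w => f (s k w)]
   <= (kappa^-1 * (1 / (t%:R + 1)) * V s_init)%:E)%E.
Proof.
move=> k0 fQ; set B := _ * V s_init.
have [[k hk]|nk] := pselect (exists k : 'I_t.+1, avg P (s k) f <= B).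
  apply: (@bigmin_inf _ _ _ _ k) => //.
  by rewrite (expectation_avg P f (finitely_valued_state k)) lee_fin.
have t0 : 0 < t%:R + 1 :> R by rewrite ltr_wpDl.
suff : \sum_(j < t.+1) kappa * B < V s_init.
  rewrite sumr_const card_ord -[_ *+ _]mulr_natl -natr1 /B.
  rewrite (_ : _ * _ = V s_init) ?ltxx //; field.
  by rewrite (gt_eqF t0) (gt_eqF k0).
apply: lt_le_trans (sum_avg_le t.+1); apply: ltr_sum.
  by apply/hasP; exists ord0; rewrite ?mem_index_enum.
move=> j _; apply: (@lt_le_trans _ _ (kappa * avg P (s j) f)).
  by rewrite ltr_pM2l // ltNge; apply/negP => h; apply: nk; exists j.
rewrite -avgZ; last exact: finitely_valued_state.
by apply: avg_le => //; exact: finitely_valued_state.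
Qed.

Lemma ae_summable : {ae P, forall w, exists M, forall k, \sum_(j < k) Q (s j w) <= M}.
Proof.
have paidE k w : paid (history k w) = \sum_(j < k) Q (s j w).
  elim: k => [|k IH]; first by rewrite /paid /= big_nil big_ord0.
  rewrite big_ord_recr /= -IH /paid /history; case: k {IH} => [|k] /=;
  by rewrite ?big_cons ?big_nil addrC.
have : {ae P, forall w, exists M, forall k, paid (history k w) <= M}.
  apply: (@ae_bounded_of_mean _ _ _ _ (fun k w => paid (history k w)) (V s_init)).
  - by move=> k; exact: (finitely_valued_measurable paid (history_finitely_valued k)).
  - by move=> k w; apply: sumr_ge0.
  - by move=> k w; rewrite !paidE big_ord_recr lerDl.
  - move=> k; rewrite (expectation_avg _ _ (history_finitely_valued k)) lee_fin avg_paid.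
    exact: sum_avg_le.
by apply: filterS => w [M hM]; exists M => k; rewrite -paidE.
Qed.

(** Gain of an investor who buys V below a and sells above b, credited with only
    b - a at each sale, plus the latent gain of the position currently held. *)
Definition upcross_potential a b (h : seq S) : R :=
  let st := upcross a b (map V h) in
  (b - a) * st.2%:R + (if st.1 then V (head s_init h) - a else 0).

(** Buying happens at a price at most a and selling at a price at least b, so
    both only lower the potential; while the position is held, the potential
    follows V. *)
Lemma upcross_potential_step a b u v h : 0 < b - a ->
  upcross_potential a b (u :: v :: h) <= upcross_potential a b (v :: h)
    + (if (upcross a b (map V (v :: h))).1 then V u - V v else 0).
Proof.
move=> ba; rewrite /upcross_potential /=.
set st := upcross_step a b (V v) _; rewrite /upcross_step.
case: st => [[] c] /=; last by rewrite addr0 lerD2l; case: ifP => // ua; lra.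
case: ifP => [bu|_] /=; last by lra.
by rewrite -[c.+1]addn1 natrD mulrDr mulr1; lra.
Qed.

(** Doob's upcrossing inequality: the investor cannot gain on average against a
    supermartingale, and owes at most a since V is nonnegative. *)
Lemma avg_upcross_le a b : 0 <= a -> a < b -> forall k,
  avg P (history k) (fun h => (upcross a b (map V h)).2%:R) <= a / (b - a).
Proof.
move=> a0 ab k; have ba : 0 < b - a by rewrite subr_gt0.
have fH := history_finitely_valued k.
have D0 : avg P (history k) (upcross_potential a b) <= 0.
  apply: le_trans (avg_potential_le _ k) _ => [v h|]; last first.
    by rewrite /upcross_potential /= mulr0 add0r; case: ifP => // va; lra.
  apply: (@le_trans _ _ (n%:R^-1 * \sum_(i < n) (upcross_potential a b (v :: h)
      + (if (upcross a b (map V (v :: h))).1 then V (step i v) - V v else 0)))).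
    apply: ler_wpM2l; rewrite ?invr_ge0 //; apply: ler_sum => i _.
    exact: upcross_potential_step.
  rewrite big_split mulrDr average_cst gerDl; case: (upcross a b _).1; last by rewrite average_cst.
  rewrite big_split /= mulrDr average_cst.
  by have := descent v; have := Q_ge0 v; lra.
rewrite ler_pdivlMr //.
suff : avg P (history k) (fun h => (b - a) * (upcross a b (map V h)).2%:R + - a) <= 0.
  by rewrite avgD // avgZ // (avg_cst P (- a) fH); lra.
apply: le_trans D0; apply: avg_le => // w; rewrite /upcross_potential lerD2l.
by case: ifP => _; rewrite ?lerBrDr ?addNr ?V_ge0 ?oppr_le0.
Qed.

Lemma ae_upcross_bounded a b : a < b ->
  {ae P, forall w, exists m, forall k, ((upcross a b (past (V \o s^~ w) k)).2 < m)%N}.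
Proof.
move=> ab.
(* For a < 0 the nonnegative V never reaches a, so nothing is counted. *)
have [a0|a0] := ltP a 0.
  apply: aeW => w; exists 1%N => k; rewrite ltnS leqn0.
  suff : upcross a b (past (V \o s^~ w) k) = (false, 0%N) by move=> ->.
  have nle v : (V v <= a) = false by apply/negbTE; rewrite -ltNge (lt_le_trans a0).
  elim: k => [|k IH]; first by rewrite /= /upcross_step /= nle.
  by rewrite upcross_pastS IH /upcross_step /= nle.
have : {ae P, forall w, exists M : R, forall k,
    (upcross a b (map V (history k w))).2%:R <= M}.
  apply: (@ae_bounded_of_mean _ _ _ _
    (fun k w => (upcross a b (map V (history k w))).2%:R) (a / (b - a))).
  - move=> k; exact: (finitely_valued_measurable
      (fun h => (upcross a b (map V h)).2%:R) (history_finitely_valued k)).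
  - by [].
  - move=> k w; rewrite ler_nat /history !map_past.
    exact: (@upcross_step_count R a b (V (s k.+1 w))).
  - move=> k; rewrite (expectation_avg P (fun h => (upcross a b (map V h)).2%:R)
      (history_finitely_valued k)) lee_fin; exact: avg_upcross_le.
apply: filterS => w [M hM]; exists (Num.trunc M).+1 => k.
have := hM k; rewrite /history map_past => h.
rewrite -(ltr_nat R); apply: le_lt_trans h _.
exact: truncnS_gt.
Qed.

(** The almost sure events are intersected over pairs of rationals, enumerated by
    their codes. *)
Lemma ae_cvg : {ae P, forall w, exists l : R, V (s k w) @[k --> \oo] --> l}.
Proof.
have freq : {ae P, forall w, exists M, forall K, exists2 k, (K <= k)%N & V (s k w) <= M}.
  apply: (@ae_liminf_bounded_of_mean _ _ _ _ (fun k w => V (s k w)) (V s_init)) => //.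
  - by move=> k; exact: (finitely_valued_measurable V (finitely_valued_state k)).
  - by move=> k; rewrite (expectation_avg P V (finitely_valued_state k)) lee_fin avg_state_le.
have ups : {ae P, forall w, forall N : nat, forall pq : rat * rat, unpickle N = Some pq ->
    pq.1 < pq.2 -> exists m, forall k,
      ((upcross (ratr pq.1) (ratr pq.2) (past (V \o s^~ w) k)).2 < m)%N}.
  apply: ae_foralln => N; case e : (unpickle N) => [pq|]; last by apply: aeW.
  have [lt|nlt] := boolP (pq.1 < pq.2); last first.
    by apply: aeW => w pq' [<-] lt; rewrite lt in nlt.
  have : (ratr pq.1 : R) < ratr pq.2 by rewrite ltr_rat.
  by move=> /ae_upcross_bounded; apply: filterS => w [m hm] pq' [<-] _; exists m.
apply: filterS2 freq ups => w fr up; apply: cvg_of_upcross_bounded => //.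
by move=> p q pq; exact: (up _ (p, q) (pickleK _)).
Qed.

End Supermartingale.
End UniformChain.

(** * Solutions of a cocoercive equation *)

Section Cocoercive.
Variables (R : realType) (N n : nat) (L : R) (A : 'I_n -> 'rV[R]_N -> 'rV[R]_N).
Hypotheses (hn : (0 < n)%N) (hL : 0 < L).
Hypothesis hA : forall i, cocoercive (1 / L) (A i).

Let n_neq0 : n%:R != 0 :> R. Proof. by rewrite pnatr_eq0 -lt0n. Qed.

Lemma cocoercive_sqdist i x y :
  L^-1 * sqdist (A i x) (A i y) <= dotp (A i x - A i y) (x - y).
Proof. by have := hA i x y; rewrite enorm_sqr div1r. Qed.

(** Cauchy-Schwarz is replaced by 0 <= |a - L b|^2 with a the difference of the
    values and b that of the points. *)
Lemma cocoercive_lipschitz i x y : sqdist (A i x) (A i y) <= L ^+ 2 * sqdist x y.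
Proof.
have h := cocoercive_sqdist i x y.
have h1 : sqdist (A i x) (A i y) <= L * dotp (A i x - A i y) (x - y).
  by rewrite -ler_pdivrMl.
have := dotp_ge0 (A i x - A i y - L *: (x - y)).
move: h1; rewrite /sqdist; move: (A i x - A i y) (x - y) => a b h1.
rewrite !dotpE (dotpC b a); nra.
Qed.

Lemma solution_sum z : solutions A z -> \sum_i A i z = 0.
Proof.
move=> /esym /eqP; rewrite /mean scaler_eq0 invr_eq0 (negbTE n_neq0) => /eqP; exact.
Qed.

(** Summing cocoercivity over i between two solutions, the right-hand sides
    cancel. *)
Lemma solution_values z z' i : solutions A z -> solutions A z' -> A i z = A i z'.
Proof.
move=> /solution_sum sz /solution_sum sz'.
have tot : \sum_i sqdist (A i z) (A i z') <= 0.
  rewrite -(pmulr_rle0 _ (_ : 0 < L^-1)) ?invr_gt0 // mulr_sumr.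
  apply: (@le_trans _ _ (\sum_i dotp (A i z - A i z') (z - z'))).
    by apply: ler_sum => j _; exact: cocoercive_sqdist.
  by rewrite -dotp_suml sumrB sz sz' subr0 dotp0l.
apply/eqP; rewrite -subr_eq0; apply/eqP/dotp_eq0; apply: le_trans tot.
by rewrite (bigD1 i) //= lerDl; apply: sumr_ge0 => j _; exact: sqdist_ge0.
Qed.

Lemma solutions_cluster (z0 : 'rV[R]_N) (u : nat -> 'rV[R]_N) p :
  solutions A z0 -> (forall k, solutions A (u k)) -> cluster_pt u p -> solutions A p.
Proof.
move=> sz0 su clp.
have Ap i : A i p = A i z0.
  apply: sqdist_eq => e e0.
  have [k _ hk] := clp (e / L ^+ 2) 0%N (divr_gt0 e0 (exprn_gt0 2 hL)).
  rewrite -(solution_values i (su k) sz0).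
  apply: le_lt_trans (cocoercive_lipschitz i _ _) _.
  by rewrite sqdistC mulrC -ltr_pdivlMr // exprn_gt0.
by rewrite /solutions /=; under eq_fun do rewrite Ap.
Qed.

(** A cluster point of a minimizing sequence: it is again a solution because all
    solutions share the values of the operators. *)
Lemma closest_solution (u0 z0 : 'rV[R]_N) : solutions A z0 ->
  exists2 p, solutions A p & forall z, solutions A z -> sqdist u0 p <= sqdist u0 z.
Proof.
move=> sz0.
pose E := [set sqdist u0 z | z in solutions A].
have lbE : has_lbound E by exists 0 => _ [z _ <-]; exact: sqdist_ge0.
have infE : has_inf E by split => //; exists (sqdist u0 z0), z0.
have m0 : 0 <= inf E.
  by apply: lb_le_inf; [exact: infE.1 | move=> _ [z _ <-]; exact: sqdist_ge0].
have /choice [u hu] k : exists z, solutions A z /\ sqdist u0 z < inf E + k.+1%:R^-1.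
  have k0 : 0 < k.+1%:R^-1 :> R by rewrite invr_gt0.
  by have [_ [z sz <-] lt] := inf_adherent k0 infE; exists z.
have [p clp] : exists p, cluster_pt u p.
  apply: (@bounded_cluster_pt _ _ u (2 * (inf E + 1) + 2 * dotp u0 u0)) => k.
  rewrite -[X in dotp X _](subrK u0) -[X in dotp _ X](subrK u0).
  apply: le_trans (dotp_add_le _ _) _; rewrite lerD2r ler_wpM2l //.
  rewrite -/(sqdist _ _) sqdistC; apply: le_trans (ltW (hu k).2) _.
  by rewrite lerD2l invf_le1 // ler1n.
have sp : solutions A p := solutions_cluster sz0 (fun k => (hu k).1) clp.
exists p => // z sz; apply: (@le_trans _ _ (inf E)); last by apply: ge_inf => //; exists z.
(* The three inequalities d1, d2, d3 below bound the squared distance to p by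
   inf E + t (inf E + 3), hence the choice of t. *)
apply/ler_addgt0Pr => e e0.
pose t := Num.min 1 (e / (inf E + 3)).
have M3 : 0 < inf E + 3 by lra.
have t0 : 0 < t by rewrite lt_min ltr01 divr_gt0.
have t1 : t <= 1 by rewrite ge_min lexx.
have te : t * (inf E + 3) <= e by rewrite -ler_pdivlMr // ge_min lexx orbT.
have ti : 0 < 1 + t^-1 by rewrite addr_gt0 // invr_gt0.
have [k kK hk] := clp (t / (1 + t^-1)) (Num.trunc t^-1) (divr_gt0 t0 ti).
have kt : k.+1%:R^-1 <= t.
  rewrite invf_ple ?posrE //; apply: ltW; apply: lt_le_trans (truncnS_gt _) _.
  by rewrite ler_nat ltnS.
have d1 : sqdist u0 (u k) <= inf E + t.
  by apply: ltW; apply: lt_le_trans (hu k).2 _; rewrite lerD2l.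
have d2 : (1 + t^-1) * sqdist (u k) p <= t.
  by rewrite mulrC -ler_pdivlMr // ltW.
have d3 : (1 + t) * sqdist u0 (u k) <= (1 + t) * (inf E + t).
  by rewrite ler_wpM2l // addr_ge0 // ltW.
have tt : t * t <= t by rewrite ler_piMr // ltW.
have := sqdist_triangle_eps u0 p (u k) t0.
lra.
Qed.

End Cocoercive.

(** * The Lyapunov function *)

Section Lyapunov.
Variables (R : realType) (N n : nat) (L lambda theta : R).
Variable A : 'I_n -> 'rV[R]_N -> 'rV[R]_N.
Hypotheses (hn : (0 < n)%N) (hL : 0 < L) (hlambda : 0 < lambda).
Hypothesis hA : forall i, cocoercive (1 / L) (A i).

Let n_neq0 : n%:R != 0 :> R. Proof. by rewrite pnatr_eq0 -lt0n. Qed.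

(** The stored values are kept as a finite function so that the states have
    decidable equality. *)
Definition svag_state := ('rV[R]_N * {ffun 'I_n -> 'rV[R]_N})%type.

Definition svag_next (i : 'I_n) (v : svag_state) : svag_state :=
  (v.1 - lambda *: ((theta / n%:R) *: (A i v.1 - v.2 i) + mean v.2),
   [ffun j => if j == i then A j v.1 else v.2 j]).

(** The change of variable that turns the biased step into an unbiased one. *)
Definition shifted (v : svag_state) : 'rV[R]_N :=
  v.1 - (lambda * (n%:R - theta)) *: mean v.2.

Definition residual (z : 'rV[R]_N) (v : svag_state) : R :=
  \sum_i (sqdist (A i v.1) (A i z) + sqdist (v.2 i) (A i z)).

Definition lyapunov (z : 'rV[R]_N) (v : svag_state) : R :=
  sqdist (shifted v) z + lambda / L * \sum_i sqdist (v.2 i) (A i z).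

Definition decrease_rate : R :=
  lambda * (L^-1 - lambda * (2 + `|n%:R - theta|)).

Lemma mean_next i v : mean (svag_next i v).2 = mean v.2 + n%:R^-1 *: (A i v.1 - v.2 i).
Proof.
rewrite /mean -scalerDr; congr (_ *: _).
rewrite [LHS](bigD1 i) // [X in X + _ = _]/= ffunE eqxx [X in _ = X + _](bigD1 i) //=.
rewrite (eq_bigr v.2); last by move=> j /negbTE ji; rewrite ffunE ji.
by rewrite [v.2 i + _]addrC -addrA [v.2 i + _]addrC subrK addrC.
Qed.

(** The weight theta / n of the innovation and the weight (n - theta) / n that it
    gets through the mean of the stored values add up to 1. *)
Lemma shifted_next i v :
  shifted (svag_next i v) = shifted v - lambda *: (A i v.1 - v.2 i + mean v.2).
Proof.
rewrite /shifted mean_next /=; move: (A i v.1 - v.2 i) (mean v.2) v.1 => g m x.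
by apply/rowP => j; rewrite !mxE; field.
Qed.

Lemma sum_sqdist_next i v z :
  \sum_j sqdist ((svag_next i v).2 j) (A j z) =
  \sum_j sqdist (v.2 j) (A j z) + sqdist (A i v.1) (A i z) - sqdist (v.2 i) (A i z).
Proof.
rewrite [LHS](bigD1 i) //= ffunE eqxx [in RHS](bigD1 i) //=.
rewrite (eq_bigr (fun j => sqdist (v.2 j) (A j z))); first by ring.
by move=> j /negbTE ji; rewrite ffunE ji.
Qed.

Lemma lyapunov_ge0 z v : 0 <= lyapunov z v.
Proof.
apply: addr_ge0; first exact: sqdist_ge0.
apply: mulr_ge0; first by rewrite divr_ge0 ?ltW.
by apply: sumr_ge0 => i _; exact: sqdist_ge0.
Qed.

Lemma residual_ge0 z v : 0 <= residual z v.
Proof. by apply: sumr_ge0 => i _; rewrite addr_ge0 // sqdist_ge0. Qed.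

Lemma mean_at_solution z (y : 'I_n -> 'rV[R]_N) : solutions A z ->
  mean (fun i => y i - A i z) = mean y.
Proof. by move=> sz; rewrite /mean sumrB (solution_sum hn sz) subr0. Qed.

Lemma lyapunov_descent z : solutions A z -> forall v,
  n%:R^-1 * \sum_i lyapunov z (svag_next i v)
  <= lyapunov z v - decrease_rate / n%:R * residual z v.
Proof.
move=> sz v.
have n0 : 0 < n%:R :> R by rewrite ltr0n.
rewrite ler_pdivrMl //.
have -> : n%:R * (lyapunov z v - decrease_rate / n%:R * residual z v)
    = n%:R * lyapunov z v - decrease_rate * residual z v by field.
pose a i := A i v.1 - A i z; pose b i := v.2 i - A i z.
have mb : mean b = mean v.2 by exact: mean_at_solution.
have coc : L^-1 * \sum_i dotp (a i) (a i) <= \sum_i dotp (a i) (v.1 - z).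
  by rewrite mulr_sumr; apply: ler_sum => i _; exact: cocoercive_sqdist.
have pE : shifted v - z = v.1 - z - (lambda * (n%:R - theta)) *: mean b.
  by rewrite mb /shifted addrAC.
have := shifted_step_descent hn hL hlambda pE erefl coc.
apply: le_trans; rewrite mb.
rewrite le_eqVlt; apply/orP; left; apply/eqP; apply: eq_bigr => i _.
rewrite /lyapunov sum_sqdist_next shifted_next /sqdist /a /b.
have -> : A i v.1 - A i z - (v.2 i - A i z) = A i v.1 - v.2 i by rewrite opprB subrKA.
by rewrite [in LHS](addrAC (shifted v)).
Qed.

Lemma residual_mean z (v : svag_state) : solutions A z ->
  dotp (mean v.2) (mean v.2) <= residual z v.
Proof.
move=> sz; rewrite -(mean_at_solution _ sz).
apply: (@le_trans _ _ (n%:R * dotp (mean (fun i => v.2 i - A i z))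
  (mean (fun i => v.2 i - A i z)))).
  by rewrite ler_peMl ?dotp_ge0 // ler1n.
apply: le_trans (mean_jensen hn _) _; apply: ler_sum => i _.
by rewrite lerDr sqdist_ge0.
Qed.

(** Where the residual vanishes, the shift u - x tends to 0, the convergence of
    the Lyapunov function becomes that of |u - z|^2, and the values A_i u tend
    to A_i z0, so that every cluster point of u is a solution. *)
Lemma svag_path_cvg (v : nat -> svag_state) (z0 : 'rV[R]_N) (s : seq 'rV[R]_N) :
  (forall z, z \in z0 :: s -> solutions A z) ->
  (forall z, solutions A z -> z - z0 \in <<[seq z' - z0 | z' <- s]>>%VS) ->
  residual z0 (v k) @[k --> \oo] --> (0 : R) ->
  (forall z, z \in z0 :: s -> exists l : R, lyapunov z (v k) @[k --> \oo] --> l) ->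
  exists p, [/\ solutions A p, sqdist (v k).1 p @[k --> \oo] --> (0 : R) &
    forall i, sqdist ((v k).2 i) (A i p) @[k --> \oo] --> (0 : R)].
Proof.
move=> sols span res0 lyap.
have sz0 : solutions A z0 by apply: sols; rewrite mem_head.
pose e k := residual z0 (v k).
have yE k i : sqdist ((v k).2 i) (A i z0) <= e k.
  rewrite /e /residual (bigD1 i) //= addrAC lerDr addr_ge0 ?sqdist_ge0 //.
  by apply: sumr_ge0 => j _; rewrite addr_ge0 ?sqdist_ge0.
have AE k i : sqdist (A i (v k).1) (A i z0) <= e k.
  rewrite /e /residual (bigD1 i) //= -addrA lerDl addr_ge0 ?sqdist_ge0 //.
  by apply: sumr_ge0 => j _; rewrite addr_ge0 ?sqdist_ge0.
pose kap := (lambda * (n%:R - theta)) ^+ 2.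
have kap0 : 0 <= kap by exact: sqr_ge0.
have ux k : sqdist (v k).1 (shifted (v k)) <= kap * e k.
  rewrite /sqdist /shifted opprB addrC subrK dotpZl dotpZr mulrA -expr2.
  by rewrite ler_wpM2l // residual_mean.
have sumy0 : \sum_i sqdist ((v k).2 i) (A i z0) @[k --> \oo] --> (0 : R).
  apply: (squeeze_cvgr _ (cvg_cst 0) res0); apply: nearW => k.
  rewrite sumr_ge0 /=; last by move=> i _; exact: sqdist_ge0.
  by apply: ler_sum => i _; rewrite lerDr sqdist_ge0.
have cvgu z : z \in z0 :: s -> exists l : R, sqdist (shifted (v k)) z @[k --> \oo] --> l.
  move=> zs; have [l hl] := lyap z zs; exists (l - lambda / L * 0).
  have -> : (fun k => sqdist (shifted (v k)) z) =
      (fun k => lyapunov z (v k) - lambda / L * \sum_i sqdist ((v k).2 i) (A i z0)).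
    apply/funext => k; rewrite /lyapunov.
    under [in RHS]eq_bigr => i _ do rewrite (solution_values hn hL hA i (sols z zs) sz0).
    by rewrite addrK.
  by apply: cvgB => //; exact: cvgMl_tmp.
have A0 : forall p, cluster_pt (fun k => shifted (v k)) p -> forall i, A i p = A i z0.
  move=> p clp i; apply: sqdist_eq => d d0.
  (* Going from A_i p to A_i z0 through A_i x and then from p to x through u
     costs 4 L^2 |p - u|^2 + C e; each term is made smaller than d / 2. *)
  pose C := 4 * L ^+ 2 * kap + 2.
  have C0 : 0 < C.
    by rewrite /C ltr_wpDl // mulr_ge0 // mulr_ge0 // sqr_ge0.
  have L4 : 0 < 4 * L ^+ 2 by rewrite mulr_gt0 // exprn_gt0.
  have dC : 0 < d / 2 / C by rewrite !divr_gt0.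
  have d4 : 0 < d / 2 / (4 * L ^+ 2) by rewrite !divr_gt0.
  move/cvgrPdist_lt : res0 => /(_ _ dC) [K _ hK].
  have [k Kk near_p] := clp _ K d4.
  have := hK k Kk; rewrite /= sub0r normrN => /(le_lt_trans (ler_norm _)).
  rewrite -/(e k) ltr_pdivlMr // => ek.
  move: near_p; rewrite ltr_pdivlMr // sqdistC => near_p.
  have h1 := sqdist_triangle (A i p) (A i z0) (A i (v k).1).
  have h2 := cocoercive_lipschitz hL hA i p (v k).1.
  have h3 := sqdist_triangle p (v k).1 (shifted (v k)).
  have h4 := ux k; rewrite sqdistC in h4.
  have h5 := AE k i.
  have h6 : L ^+ 2 * sqdist p (v k).1 <=
      L ^+ 2 * (2 * sqdist p (shifted (v k)) + 2 * (kap * e k)).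
    by rewrite ler_wpM2l ?sqr_ge0 //; apply: le_trans h3 _; lra.
  move: ek; rewrite /C; lra.
have clS p : cluster_pt (fun k => shifted (v k)) p -> solutions A p.
  by move=> /A0 Ap; rewrite /solutions /=; under eq_fun do rewrite Ap.
have [p sp up] := opial_finite span cvgu clS.
exists p; split => //.
- have bnd : 2 * (kap * e k) + 2 * sqdist (shifted (v k)) p @[k --> \oo] --> (0 : R).
    rewrite (_ : 0 = 2 * (kap * 0) + 2 * 0); last by rewrite !mulr0 addr0.
    by apply: cvgD; do ?apply: cvgMl_tmp.
  apply: (squeeze_cvgr _ (cvg_cst 0) bnd); apply: nearW => k.
  rewrite sqdist_ge0 /=; apply: le_trans (sqdist_triangle _ _ (shifted (v k))) _.
  by rewrite lerD2r ler_wpM2l.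
- move=> i; apply: (squeeze_cvgr _ (cvg_cst 0) res0); apply: nearW => k.
  by rewrite sqdist_ge0 /= (solution_values hn hL hA i sp sz0) yE.
Qed.

End Lyapunov.

(** * Convergence of the iterates *)

Lemma cvg0_of_bounded_sums (R : realType) (q : nat -> R) M :
  (forall k, 0 <= q k) -> (forall k, \sum_(j < k) q j <= M) -> q k @[k --> \oo] --> (0 : R).
Proof.
move=> q0 qM; apply: cvg_series_cvg_0; apply: nondecreasing_is_cvgn.
  by apply/nondecreasing_seqP => k; rewrite /series /= big_nat_recr //= lerDl.
by exists M => _ [k _ <-]; rewrite /series /= big_mkord.
Qed.

Lemma sigma_algebra_forall (T : Type) (G : set (set T)) m (B : 'I_m -> set T) :
  sigma_algebra setT G -> (0 < m)%N -> (forall j, G (B j)) -> G [set w | forall j, B j w].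
Proof.
move=> sG m0 GB.
have -> : [set w | forall j, B j w] = \bigcap_(j in [set: 'I_m]) B j.
  by apply/seteqP; split => w h j; [move=> _; exact: h | exact: h].
apply: ((finN0_bigcap_closedP G).1 (sigma_algebra_setI sG)) => //.
by exists (Ordinal m0).
Qed.

Lemma vec_measurable_fiber (R : realType) N (T : Type) (G : set (set T))
    (X : T -> 'rV[R]_N) p :
  sigma_algebra setT G -> (0 < N)%N -> vec_measurable G X -> G (X @^-1` [set p]).
Proof.
move=> sG N0 mX.
have -> : X @^-1` [set p] = [set w | forall j, ((fun w => X w 0 j) @^-1` [set p 0 j]) w].
  by apply/seteqP; split => w /=; [move=> -> | move=> h; apply/rowP].
by apply: sigma_algebra_forall => // j; apply: mX.
Qed.

Lemma svag_chain (R : realType) (N n : nat) (d : measure_display)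
    (T : measurableType d) (P : probability T R)
    (A : 'I_n -> 'rV[R]_N -> 'rV[R]_N) (lambda theta : R)
    (x0 : 'rV[R]_N) (y0 : 'I_n -> 'rV[R]_N)
    (F : nat -> set (set T)) (I : nat -> T -> 'I_n)
    (x : nat -> T -> 'rV[R]_N) (y : nat -> 'I_n -> T -> 'rV[R]_N) :
  (0 < N)%N -> (0 < n)%N -> svag P A lambda theta x0 y0 F I x y ->
  uniform_chain P (svag_next lambda theta A)
    ((x0, [ffun i => y0 i]) : svag_state R N n) F I
    (fun k w => (x k w, [ffun i => y k i w])).
Proof.
move=> N0 n0 [sF mF iF xF yF mI uI indI xi yi xs ys]; split => //.
- move=> k v.
  have -> : (fun w => (x k w, [ffun i => y k i w])) @^-1` [set v] =
      x k @^-1` [set v.1] `&` [set w | forall i, (y k i @^-1` [set v.2 i]) w].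
    apply/seteqP; split => w /=.
      by move=> <-; split => //= i; rewrite ffunE.
    by case: v => v1 v2 /= [-> h]; congr pair; apply/ffunP => i; rewrite ffunE.
  apply: (sigma_algebra_setI (sF k)); first exact: vec_measurable_fiber.
  by apply: sigma_algebra_forall => // i; exact: vec_measurable_fiber.
- by move=> w; rewrite xi; congr pair; apply/ffunP => i; rewrite !ffunE yi.
- move=> k w; rewrite xs /svag_next /= ffunE; congr pair; last first.
    by apply/ffunP => i; rewrite !ffunE ys.
  do 4 f_equal; rewrite /mean; congr (_ *: _); apply: eq_bigr => i _; by rewrite ffunE.
Qed.

Theorem theorem3p1 (R : realType) (N n : nat) (hN : (1 <= N)%N) (hn : (1 <= n)%N)
    (L : R) (hL : 0 < L)
    (A : 'I_n -> 'rV[R]_N -> 'rV[R]_N)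
    (hA : forall i : 'I_n, cocoercive (1 / L) (A i))
    (hsol : solutions A !=set0)
    (d : measure_display) (T : measurableType d) (P : probability T R)
    (lambda theta : R) (hlambda : 0 < lambda)
    (x0 : 'rV[R]_N) (y0 : 'I_n -> 'rV[R]_N)
    (F : nat -> set (set T)) (I : nat -> T -> 'I_n)
    (x : nat -> T -> 'rV[R]_N) (y : nat -> 'I_n -> T -> 'rV[R]_N)
    (hsvag : svag P A lambda theta x0 y0 F I x y)
    (hstep : 1 / (L * (2 + `|n%:R - theta|)) > lambda) :
  let c : R := 2 + `|n%:R - theta| in
  (exists xstar : T -> 'rV[R]_N,
    [/\ vec_measurable measurable xstar,
        forall w : T, solutions A (xstar w)
      & {ae P, forall w : T,
          (x k w @[k --> \oo] --> xstar w) /\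
          (forall i : 'I_n, y k i w @[k --> \oo] --> A i (xstar w))}]) /\
  (forall xstar : 'rV[R]_N, solutions A xstar ->
    exists CR : R,
      is_minimum
        [set CR_objective A L lambda theta x0 y0 xstar z | z in solutions A] CR /\
      forall (i : 'I_n) (t : nat),
        (\big[Order.min/+oo%E]_(k < t.+1)
           'E_P[fun w : T => (enorm (A i (x k w) - A i xstar) ^+ 2)%R]
         <= (n%:R / (lambda * (L^-1 - lambda * c)) * (1 / (t%:R + 1)) * CR)%:E)%E /\
        (\big[Order.min/+oo%E]_(k < t.+1)
           'E_P[fun w : T => (enorm (y k i w - A i xstar) ^+ 2)%R]
         <= (n%:R / (lambda * (L^-1 - lambda * c)) * (1 / (t%:R + 1)) * CR)%:E)%E).
Proof.
move=> c.
have c0 : 0 < c by rewrite /c ltr_pwDl.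
have rate0 : 0 < lambda * (L^-1 - lambda * c).
  rewrite mulr_gt0 // subr_gt0 -ltr_pdivlMr //.
  by move: hstep; rewrite -/c div1r invfM.
have n0 : 0 < n%:R :> R by rewrite ltr0n.
pose kappa := lambda * (L^-1 - lambda * c) / n%:R.
have kappa0 : 0 < kappa by rewrite divr_gt0.
pose s k w : svag_state R N n := (x k w, [ffun i => y k i w]).
have chain := svag_chain hN hn hsvag; rewrite -/s in chain.
have V0 z (v : svag_state R N n) : 0 <= lyapunov L lambda theta A z v by exact: lyapunov_ge0.
have Q0 z (v : svag_state R N n) : 0 <= kappa * residual A z v.
  by rewrite mulr_ge0 ?residual_ge0 // ltW.
have desc z : solutions A z -> forall v, n%:R^-1 * \sum_i lyapunov L lambda theta A z
    (svag_next lambda theta A i v) <= lyapunov L lambda theta A z v - kappa * residual A z v.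
  by move=> sz v; exact: lyapunov_descent.
split.
- have [z0 sz0] := hsol.
  have [sp spS span] := finite_affine_span (solutions A) z0.
  have sols z : z \in z0 :: sp -> solutions A z.
    by rewrite inE => /orP[/eqP ->|/spS].
  have ae_res : {ae P, forall w, residual A z0 (s k w) @[k --> \oo] --> (0 : R)}.
    have := ae_summable chain hn (V0 z0) (Q0 z0) (desc z0 sz0).
    apply: filterS => w [M hM].
    have h := cvg0_of_bounded_sums (fun k => Q0 z0 (s k w)) hM.
    rewrite (_ : 0 = kappa^-1 * 0); last by rewrite mulr0.
    have -> : (fun k => residual A z0 (s k w)) =
        (fun k => kappa^-1 * (kappa * residual A z0 (s k w))).
      by apply/funext => k; rewrite mulKf // gt_eqF.
    exact: cvgMl_tmp.
  (* The default value z0 of nth is a solution, so all indices j are allowed. *)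
  have ae_lyap : {ae P, forall w, forall j : nat, exists l : R,
      lyapunov L lambda theta A (nth z0 (z0 :: sp) j) (s k w) @[k --> \oo] --> l}.
    apply: ae_foralln => j.
    have sz : solutions A (nth z0 (z0 :: sp) j).
      have [jlt|jge] := ltnP j (size (z0 :: sp)); first exact/sols/mem_nth.
      by rewrite nth_default.
    exact: (ae_cvg chain hn (V0 _) (Q0 _) (desc _ sz)).
  have ae_path : {ae P, forall w, exists p, [/\ solutions A p,
      sqdist (x k w) p @[k --> \oo] --> (0 : R) &
      forall i, sqdist (y k i w) (A i p) @[k --> \oo] --> (0 : R)]}.
    apply: filterS2 ae_res ae_lyap => w res lyap.
    have [p [sp' xp yp]] := @svag_path_cvg _ _ _ L lambda theta A hn hL hA
      (fun k => s k w) z0 sp sols span res ltac:(by move=> z /(nthP z0)[j _ <-]).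
    exists p; split => // i.
    by have := yp i; under eq_fun do rewrite ffunE.
  (* Outside the measurable null set M the limit exists; on M the value z0 keeps
     the limit measurable and in the solution set. *)
  case: ae_path => M [mM M0 subM].
  have pick w : exists p, solutions A p /\ (~ M w ->
      sqdist (x k w) p @[k --> \oo] --> (0 : R) /\
      forall i, sqdist (y k i w) (A i p) @[k --> \oo] --> (0 : R)).
    have [Mw|nMw] := pselect (M w); first by exists z0.
    have : exists p, [/\ solutions A p,
      sqdist (x k w) p @[k --> \oo] --> (0 : R) &
      forall i, sqdist (y k i w) (A i p) @[k --> \oo] --> (0 : R)].
      by apply: contrapT => h; apply: nMw; apply: subM.
    by move=> [p [sp' xp yp]]; exists p.
  have /choice [q hq] := pick.
  pose xs w := if w \in M then z0 else q w.
  exists xs; split.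
  + move=> j B mB.
    have mx k : measurable_fun setT (fun w => x k w 0 j).
      move=> _ Y mY; rewrite setTI.
      by apply: (svag_filtration_sub hsvag (k := k)); apply: (svag_x_adapted hsvag).
    have mlim : measurable_fun setT (fun w => xs w 0 j).
      (* Cutting x off on M makes the convergence hold everywhere. *)
      apply: (@measurable_fun_cvg _ _ _ _
        (fun k w => \1_M w * z0 0 j + \1_(~` M) w * x k w 0 j)).
        move=> k; apply: measurable_funD; apply: measurable_funM => //.
          by apply: measurable_indic; exact: measurableC.
      move=> w _; rewrite /xs; have [Mw|nMw] := boolP (w \in M).
        rewrite !indicE in_setC Mw /=.
        under eq_fun do rewrite mul1r mul0r addr0; exact: cvg_cst.
      rewrite !indicE in_setC nMw (negbTE nMw) /=.
      under eq_fun do rewrite mul1r mul0r add0r.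
      have nMw' : ~ M w by move=> /mem_set Mw; rewrite Mw in nMw.
      by apply: coord_cvg_of_sqdist; exact: ((hq w).2 nMw').1.
    by have := mlim measurableT B mB; rewrite setTI.
  + by move=> w; rewrite /xs; case: ifP => // _; exact: (hq w).1.
  + exists M; split => // w nw; apply: contrapT => nMw; apply: nw.
    have [xq yq] := (hq w).2 nMw.
    rewrite /= /xs memNset //; split; first exact: cvg_of_sqdist.
    by move=> i; apply: cvg_of_sqdist.
- move=> xstar sxs.
  pose u0 := x0 - (lambda * (n%:R - theta)) *: mean y0.
  have [p sp pmin] := closest_solution hn hL hA u0 sxs.
  pose v0 : svag_state R N n := (x0, [ffun i => y0 i]).
  have my0 : mean v0.2 = mean y0.
    by rewrite /mean /=; congr (_ *: _); apply: eq_bigr => i _; rewrite ffunE.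
  have objE z : CR_objective A L lambda theta x0 y0 xstar z =
      sqdist u0 z + lambda / L * \sum_i sqdist (y0 i) (A i xstar).
    rewrite /CR_objective !enorm_sqr; under eq_bigr do rewrite enorm_sqr.
    rewrite /sqdist /u0 [x0 - _ - z]addrAC.
    move: (x0 - z) (mean y0) (\sum_i _) => a m S.
    rewrite !dotpE (dotpC m a); ring.
  have lyapE : lyapunov L lambda theta A p v0 = CR_objective A L lambda theta x0 y0 xstar p.
    rewrite objE /lyapunov /shifted my0 /=; congr (_ + _ * _); apply: eq_bigr => i _.
    by rewrite ffunE (solution_values hn hL hA i sp sxs).
  exists (CR_objective A L lambda theta x0 y0 xstar p); split.
    split; first by exists p.
    by move=> _ [z sz <-]; rewrite !objE lerD2r; exact: pmin.
  move=> i t; rewrite -lyapE.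
  have term (f : svag_state R N n -> R) : (forall v, f v <= residual A p v) ->
      (\big[Order.min/+oo]_(k < t.+1) 'E_P[fun w => f (s k w)] <=
       (n%:R / (lambda * (L^-1 - lambda * c)) * (1 / (t%:R + 1))
         * lyapunov L lambda theta A p v0)%:E)%E.
    move=> fr; rewrite -[n%:R / _]invf_div -/kappa.
    have fQ v : kappa * f v <= kappa * residual A p v by rewrite ler_wpM2l // ltW.
    have := min_expectation_le chain hn (V0 p) (desc p sp) t kappa0 fQ.
    by [].
  split.
  + under eq_bigr do under eq_fun do rewrite enorm_sqr.
    apply: (term (fun v => sqdist (A i v.1) (A i xstar))) => v.
    rewrite -(solution_values hn hL hA i sp sxs) /residual (bigD1 i) //= -addrA lerDl.
    by rewrite addr_ge0 ?sqdist_ge0 // sumr_ge0 // => j _; rewrite addr_ge0 ?sqdist_ge0.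
  + rewrite (eq_bigr (fun k : 'I_t.+1 =>
        ('E_P[fun w => sqdist ((s k w).2 i) (A i xstar)])%E)); last first.
      move=> k _; congr ('E_P[_])%E; apply/funext => w.
      by rewrite enorm_sqr /= ffunE.
    apply: (term (fun v => sqdist (v.2 i) (A i xstar))) => v.
    rewrite -(solution_values hn hL hA i sp sxs) /residual (bigD1 i) //= addrAC lerDr.
    by rewrite addr_ge0 ?sqdist_ge0 // sumr_ge0 // => j _; rewrite addr_ge0 ?sqdist_ge0.
Qed.
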